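(* Let $t\in[0,1)$, $x_t\in\{1,\dots,S\}^D$, $d\in\{1,\dots,D\}$ and $\Delta t>0$. Then for every $j^d\in\{1,\dots,S\}$ with $j^d\neq x_t^d$, the reverse generative rate of uniform discrete diffusion in dimension $d$ satisfies $$R_t^{\mathrm{unif}}(x_t,j^d)\,\Delta t=\frac{\dot\alpha_t}{1-\alpha_t}\,p_{1|t}(x_1^d=j^d\mid x_t)\,\Delta t=\frac{\dot\alpha_t}{1-\alpha_t}\;p(z_t^d=N\mid x_t)\;p_{1|t}(x_1^d=j^d\mid x_t,z_t^d=N)\,\Delta t,$$ where $$p(z_t^d=N\mid x_t)=1-p_{1|t}(x_1^d=x_t^d\mid x_t)\,\frac{\alpha_t}{\alpha_t+(1-\alpha_t)/S},$$ and, for $j^d\neq x_t^d$, $$p_{1|t}(x_1^d=j^d\mid x_t,z_t^d=N)=\frac{p_{1|t}(x_1^d=j^d\mid x_t)}{p(z_t^d=N\mid x_t)}.$$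
   Context: Fix integers $S\ge 2$, $D\ge 1$ and a probability mass function $p_{\mathrm{data}}$ on $\{1,\dots,S\}^D$. The noise schedule $\alpha:[0,1]\to[0,1]$ is differentiable and nondecreasing, with $\alpha_0=0$, $\alpha_1=1$ and $\alpha_t<1$ for $t<1$; $\dot\alpha_t$ is its time derivative. Time $t=0$ is noise and $t=1$ is data. $\delta\{a,b\}$ is the Kronecker delta. Uniform corruption process: draw $x_1\sim p_{\mathrm{data}}$. Given $x_1$, independently for each dimension $d$, draw a latent $z_t^d\in\{N,D\}$ ($N$ = noise, $D$ = data; this symbol is unrelated to the dimension count) with $P(z_t^d=D)=\alpha_t$, $P(z_t^d=N)=1-\alpha_t$. If $z_t^d=D$ then $x_t^d=x_1^d$; if $z_t^d=N$ then $x_t^d$ is uniform on $\{1,\dots,S\}$ (independently of $x_1$, so it may coincide with $x_1^d$). All probabilities $p(\cdot)$, and the posteriors $p_{1|t}(\cdot\mid\cdot)$ of $x_1$ (or $x_1^d$) given quantities at time $t$, refer to the joint law of $(x_1,z_t,x_t)$ so defined. The data-conditional reverse rate in dimension $d$, for $j^d\ne x_t^d$, is $$R_t^{\mathrm{unif}}(x_t,j^d\mid x_1)=\frac{\dot\alpha_t}{1-\alpha_t}\,\delta\{x_1^d,j^d\}\,(1-\delta\{x_1^d,x_t^d\}),$$ and the reverse generative rate is its posterior expectation $$R_t^{\mathrm{unif}}(x_t,j^d)=\sum_{x_1}p_{1|t}(x_1\mid x_t)\,R_t^{\mathrm{unif}}(x_t,j^d\mid x_1).$$ *)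

(* Defs.v *)
From HB Require Import structures.
From mathcomp Require Import all_boot all_order all_algebra.
From mathcomp Require Import all_classical all_reals all_analysis.

Set Implicit Arguments.
Unset Strict Implicit.
Unset Printing Implicit Defensive.

Import Order.TTheory GRing.Theory Num.Theory.
Import numFieldNormedType.Exports.

Local Open Scope classical_set_scope.
Local Open Scope ring_scope.

Section FiniteProbability.
Variables (R : realType) (T : finType).
Implicit Types (P : T -> R) (A B : {pred T}).

Definition is_pmf P : Prop := (forall w, 0 <= P w) /\ \sum_w P w = 1.

Definition Pr P A : R := \sum_(w in A) P w.

(* Division by 0 is 0 here, so this is meaningful only when [Pr P B != 0].
   In the corruption process below, for [0 <= t < 1], every [x_t] and every
   pair [(x_t, z_t^d = N)] has positive probability. *)
Definition condPr P A B : R := Pr P [predI A & B] / Pr P B.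

End FiniteProbability.

Section NoiseSchedule.
Variable R : realType.
Implicit Types (alpha : R -> R) (t : R).

(* The schedule lives on [0, 1] only: difference quotients are restricted to
   [0, 1], so that derivatives at 0 and 1 are one-sided and the values of
   [alpha] outside [0, 1] are irrelevant. *)
Definition quotient01 alpha t : set_system R :=
  (fun s => (alpha s - alpha t) / (s - t)) @ within `[0, 1] t^'.

Definition derive01 alpha t : R := lim (quotient01 alpha t).

Record noise_schedule alpha : Prop := NoiseSchedule {
  schedule_range : forall t, 0 <= t <= 1 -> 0 <= alpha t <= 1;
  schedule_differentiable : forall t, 0 <= t <= 1 -> cvg (quotient01 alpha t);
  schedule_nondecreasing :
    forall s t, 0 <= s -> s <= t -> t <= 1 -> alpha s <= alpha t;
  schedule0 : alpha 0 = 0;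
  schedule1 : alpha 1 = 1;
  schedule_lt1 : forall t, 0 <= t -> t < 1 -> alpha t < 1
}.

End NoiseSchedule.

(* The states {1, ..., S} are encoded as ['I_S] = {0, ..., S - 1}. *)
Definition config (S D : nat) := {ffun 'I_D -> 'I_S}.

Variant latent := Noise | Data.

Definition latent_to_bool (a : latent) : bool :=
  if a is Data then true else false.
Definition bool_to_latent (b : bool) : latent := if b then Data else Noise.
Lemma latent_to_boolK : cancel latent_to_bool bool_to_latent.
Proof. by case. Qed.
HB.instance Definition _ := Finite.copy latent (can_type latent_to_boolK).

Section UniformCorruption.
Variables (R : realType) (S D : nat).
Variables (pdata : config S D -> R) (alpha : R -> R).
Implicit Types (t : R) (x : config S D) (d : 'I_D) (j : 'I_S).

Definition outcome : finType :=
  (config S D * {ffun 'I_D -> latent} * config S D)%type.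

Definition clean_of (w : outcome) : config S D := w.1.1.
Definition latent_of (w : outcome) : {ffun 'I_D -> latent} := w.1.2.
Definition noisy_of (w : outcome) : config S D := w.2.

Definition latent_pmf t (a : latent) : R :=
  match a with Data => alpha t | Noise => 1 - alpha t end.

Definition emission_pmf (a : latent) (i1 i : 'I_S) : R :=
  match a with Data => (i == i1)%:R | Noise => S%:R^-1 end.

Definition joint_pmf t (w : outcome) : R :=
  pdata (clean_of w) *
  \prod_d (latent_pmf t (latent_of w d) *
           emission_pmf (latent_of w d) (clean_of w d) (noisy_of w d)).

Definition noisy_is x : {pred outcome} := [pred w | noisy_of w == x].
Definition clean_is (x1 : config S D) : {pred outcome} := [pred w | clean_of w == x1].
Definition clean_at d j : {pred outcome} := [pred w | clean_of w d == j].
Definition noise_at d : {pred outcome} := [pred w | latent_of w d == Noise].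

Definition post_clean t (x1 : config S D) x : R :=
  condPr (joint_pmf t) (clean_is x1) (noisy_is x).

Definition post_clean_at t d j x : R :=
  condPr (joint_pmf t) (clean_at d j) (noisy_is x).

Definition post_noise_at t d x : R :=
  condPr (joint_pmf t) (noise_at d) (noisy_is x).

Definition post_clean_at_noise t d j x : R :=
  condPr (joint_pmf t) (clean_at d j) [predI noisy_is x & noise_at d].

(* Rates are only meaningful for [j != x d]: no diagonal convention is set. *)
Definition cond_rate t x d j (x1 : config S D) : R :=
  derive01 alpha t / (1 - alpha t) *
  (x1 d == j)%:R * (1 - (x1 d == x d)%:R).

Definition rate t x d j : R :=
  \sum_x1 post_clean t x1 x * cond_rate t x d j x1.

End UniformCorruption.

(* Main.v *)
(* If z_t^d = D then x_t^d = x_1^d, so on {x_1^d = j^d, x_t} with j^d <> x_t^d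
   the latent z_t^d is almost surely N: conditioning on it costs nothing but the
   factor p(z_t^d = N | x_t).  On {x_1^d = x_t^d, x_t}, switching z_t^d from D
   to N replaces the factor alpha_t of the joint law by (1 - alpha_t) / S, which
   gives the posterior odds of the two values of z_t^d. *)
Require Import Defs.
From mathcomp Require Import all_boot all_order all_algebra.
From mathcomp Require Import all_classical all_reals all_analysis.
From mathcomp Require Import ring.

Set Implicit Arguments.
Unset Strict Implicit.
Unset Printing Implicit Defensive.

Import Order.TTheory GRing.Theory Num.Theory.

Local Open Scope ring_scope.

Section PrTheory.
Variables (R : realType) (T : finType).
Implicit Types (P : T -> R) (A B : {pred T}).

(** Agreement is required on the support of [P] only; almost sure relations between latent, clean
    and noisy values enter the proof through this. *)
Lemma eq_Pr P A B :
  (forall w, P w != 0 -> (w \in A) = (w \in B)) -> Pr P A = Pr P B.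
Proof.
move=> AB; rewrite /Pr [LHS]big_mkcond [RHS]big_mkcond /=.
apply: eq_bigr => w _; have [->|/AB ->//] := eqVneq (P w) 0.
by rewrite !if_same.
Qed.

Lemma Pr_predID P A B : Pr P A = Pr P [predI A & B] + Pr P [predD A & B].
Proof.
rewrite /Pr (bigID (mem B)) /=; congr (_ + _).
by apply: eq_bigl => w; rewrite !inE andbC.
Qed.

Lemma le_Pr P A B : (forall w, 0 <= P w) -> {subset A <= B} ->
  Pr P A <= Pr P B.
Proof.
move=> P_ge0 AB; rewrite /Pr [leLHS]big_mkcond [leRHS]big_mkcond /=.
apply: ler_sum => w _; case: ifP => [/AB ->//|_]; by case: ifP.
Qed.

End PrTheory.

Section Corruption.
Variables (R : realType) (S D : nat).
Variables (pdata : config S D -> R) (alpha : R -> R).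
Variables (t : R) (x : config S D) (d : 'I_D).

Local Notation P := (joint_pmf pdata alpha t).
Local Notation noisy := (@noisy_is S D x).
Local Notation noise := (@noise_at S D d).
Local Notation clean := (@clean_at S D d).

Lemma sum_post_clean j :
  \sum_(x1 : config S D | x1 d == j) post_clean pdata alpha t x1 x =
  post_clean_at pdata alpha t d j x.
Proof.
rewrite /post_clean /post_clean_at /condPr -mulr_suml; congr (_ / _).
rewrite /Pr [RHS](partition_big (@clean_of S D) (fun x1 => x1 d == j)) /=; last first.
  by move=> w; rewrite !inE => /andP[].
apply: eq_bigr => x1 x1j; apply: eq_bigl => w; rewrite !inE.
by case: eqVneq => [->|]; rewrite ?x1j ?andbF ?andbT.
Qed.

(** Only terms with [x1 d = j] survive, and there [j != x d] turns the factor [1 - (x1 d == x d)%:R]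
    into 1; what remains is the marginal posterior at [d]. *)
Lemma rateE j : j != x d ->
  rate pdata alpha t x d j =
  derive01 alpha t / (1 - alpha t) * post_clean_at pdata alpha t d j x.
Proof.
move=> jx; rewrite /rate -sum_post_clean mulr_sumr [RHS]big_mkcond /=.
apply: eq_bigr => x1 _; rewrite /cond_rate; case: (eqVneq (x1 d) j) => [->|_].
  by rewrite (negbTE jx) subr0 !mulr1 mulrC.
by rewrite mulr0 mul0r mulr0.
Qed.

(** The emission factor at [d] is then a Kronecker delta with distinct arguments. *)
Lemma joint_data_eq0 (w : outcome S D) :
  latent_of w d = Data -> noisy_of w d != clean_of w d -> P w = 0.
Proof.
move=> wD /negbTE w_neq; rewrite /joint_pmf (bigD1 d) //= wD /= w_neq.
by rewrite mulr0 mul0r mulr0.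
Qed.

Lemma Pr_clean_noisy_noise j : j != x d ->
  Pr P [predI clean j & [predI noisy & noise]] = Pr P [predI clean j & noisy].
Proof.
move=> jx; apply: eq_Pr => w Pw; rewrite !inE.
case: (eqVneq (clean_of w d) j) => //= wj.
case: (eqVneq (noisy_of w) x) => //= wx.
case: eqP => // wN; case/eqP: Pw; apply: joint_data_eq0.
  by case: (latent_of w d) wN.
by rewrite wx wj eq_sym.
Qed.

(** A data latent at [d] forces the clean value there to be [x d], so the added constraint loses no
    mass. This brings the data event to the set where the odds of the two latents are known. *)
Lemma Pr_noisy_data :
  Pr P [predD noisy & noise] = Pr P [predD [predI clean (x d) & noisy] & noise].
Proof.
apply: eq_Pr => w Pw; rewrite !inE; case: eqP => //= wN.
case: (eqVneq (noisy_of w) x) => [wx|]; rewrite ?andbF // andbT.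
apply/esym/negPn/negP => w_neq; case/eqP: Pw; apply: joint_data_eq0.
  by case: (latent_of w d) wN.
by rewrite wx eq_sym.
Qed.

(** Pairs each outcome having a data latent at [d] with the one having a noise latent there and the
    same clean and noisy values. *)
Definition switch_latent (w : outcome S D) : outcome S D :=
  (clean_of w,
   [ffun i => if i == d then if latent_of w i is Data then Noise else Data
              else latent_of w i],
   noisy_of w).

Lemma switch_latentK : involutive switch_latent.
Proof.
move=> [[x1 z] y]; rewrite /switch_latent /clean_of /latent_of /noisy_of /=.
congr (_, _, _); apply/ffunP => i; rewrite !ffunE.
by case: eqP => // _; case: (z i).
Qed.

(** The two products differ in factor [d] alone: [alpha t] against [(1 - alpha t) / S%:R]. The
    cross-multiplied form remains valid when [alpha t = 0], as at time 0. *)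
Lemma joint_switch_latent (w : outcome S D) :
  latent_of w d = Data -> noisy_of w d = clean_of w d ->
  P w * ((1 - alpha t) / S%:R) = alpha t * P (switch_latent w).
Proof.
move=> wD w_eq; rewrite /joint_pmf (bigD1 d) //= [in RHS](bigD1 d) //=.
rewrite /switch_latent /clean_of /latent_of /noisy_of /= in wD w_eq *.
rewrite ffunE eqxx wD /= w_eq eqxx mulr1.
under [in RHS]eq_bigr => i /negbTE i_neq do rewrite ffunE i_neq.
by rewrite mulrCA !mulrA -!mulrA; ring.
Qed.

Lemma Pr_data_odds :
  Pr P [predD [predI clean (x d) & noisy] & noise] * ((1 - alpha t) / S%:R) =
  alpha t * Pr P [predI [predI clean (x d) & noisy] & noise].
Proof.
rewrite /Pr mulr_suml mulr_sumr.
rewrite [RHS](reindex_inj (inv_inj switch_latentK)) /=.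
apply: eq_big => [w|w].
  rewrite !inE /switch_latent /clean_of /latent_of /noisy_of /= ffunE eqxx andbC.
  by case: (w.1.2 d).
rewrite !inE => /and3P[wN /eqP w_eq /eqP wx].
by apply: joint_switch_latent; [case: (latent_of w d) wN | rewrite wx w_eq].
Qed.

Lemma joint_pmf_ge0 w :
  (forall x1, 0 <= pdata x1) -> 0 <= alpha t <= 1 -> 0 <= P w.
Proof.
move=> pdata_ge0 /andP[alpha_ge0 alpha_le1]; apply: mulr_ge0 => //.
apply: prodr_ge0 => i _; apply: mulr_ge0; case: (latent_of w i) => //=.
by rewrite subr_ge0.
Qed.

(* Already the outcomes whose latents are all N have positive total mass. *)
Lemma Pr_noisy_noise_gt0 : (0 < S)%N -> is_pmf pdata -> 0 <= alpha t < 1 ->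
  0 < Pr P [predI noisy & noise].
Proof.
move=> S_gt0 [pdata_ge0 pdata1] /andP[alpha_ge0 alpha_lt1].
have P_ge0 w : 0 <= P w.
  by apply: joint_pmf_ge0; rewrite // alpha_ge0 ltW.
pose all_noise (x1 : config S D) : outcome S D := (x1, [ffun=> Noise], x).
have all_noise_inj : injective all_noise by move=> x1 x2 [].
pose A : {pred outcome S D} := [pred w | w \in codom all_noise].
apply: (@lt_le_trans _ _ (Pr P A)); last first.
  apply: le_Pr => // _ /codomP[x1 ->].
  by rewrite !inE /noisy_of /latent_of /= ffunE !eqxx.
(* With all latents equal to [Noise], the product over the [D] coordinates does not depend on [x1],
   and [pdata] sums to 1. *)
have -> : Pr P A = ((1 - alpha t) / S%:R) ^+ D.
  rewrite /Pr (eq_bigl [in codom all_noise]) // -big_uniq /=; last first.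
    by rewrite map_inj_uniq ?enum_uniq.
  rewrite big_image /= -[RHS]mul1r -[in X in X * _]pdata1 mulr_suml.
  apply: eq_bigr => x1 _; rewrite /joint_pmf; congr (_ * _).
  under eq_bigr => i _ do rewrite /latent_of /= ffunE /=.
  by rewrite prodr_const card_ord.
by rewrite exprn_gt0 // divr_gt0 ?subr_gt0 ?ltr0n.
Qed.

End Corruption.

Theorem proposition3p1 (R : realType) (S D : nat)
    (S_ge2 : (2 <= S)%N) (D_ge1 : (1 <= D)%N)
    (pdata : config S D -> R) (pdata_pmf : is_pmf pdata)
    (alpha : R -> R) (alpha_schedule : noise_schedule alpha)
    (t : R) (t_ge0 : 0 <= t) (t_lt1 : t < 1)
    (x : config S D) (d : 'I_D) (dt : R) (dt_gt0 : 0 < dt) :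
  [/\ forall j : 'I_S, j != x d ->
        rate pdata alpha t x d j * dt =
          derive01 alpha t / (1 - alpha t) *
          post_clean_at pdata alpha t d j x * dt
        /\
        derive01 alpha t / (1 - alpha t) *
        post_clean_at pdata alpha t d j x * dt =
          derive01 alpha t / (1 - alpha t) *
          post_noise_at pdata alpha t d x *
          post_clean_at_noise pdata alpha t d j x * dt,
      post_noise_at pdata alpha t d x =
        1 - post_clean_at pdata alpha t d (x d) x *
            (alpha t / (alpha t + (1 - alpha t) / S%:R))
    & forall j : 'I_S, j != x d ->
        post_clean_at_noise pdata alpha t d j x =
          post_clean_at pdata alpha t d j x / post_noise_at pdata alpha t d x].
Proof.
have S_gt0 : (0 < S)%N by exact: ltnW.
have [alpha_ge0 alpha_lt1] : 0 <= alpha t /\ alpha t < 1.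
  split; last exact: schedule_lt1.
  by have /andP[] := schedule_range alpha_schedule (t := t) ltac:(by rewrite t_ge0 ltW).
have alpha01 : 0 <= alpha t < 1 by rewrite alpha_ge0.
(* This and [noisy_gt0] make both conditioning events non-null, so no [condPr] below takes its
   default value 0. *)
have noise_gt0 := Pr_noisy_noise_gt0 x d S_gt0 pdata_pmf alpha01.
have noisy_gt0 : 0 < Pr (joint_pmf pdata alpha t) (noisy_is x).
  apply: lt_le_trans noise_gt0 _; apply: le_Pr => [w|w]; last by case/andP.
  by apply: joint_pmf_ge0; [case: pdata_pmf | rewrite alpha_ge0 ltW].
have noiseE : post_noise_at pdata alpha t d x =
    Pr (joint_pmf pdata alpha t) [predI noisy_is x & noise_at d] /
    Pr (joint_pmf pdata alpha t) (noisy_is x).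
  by rewrite /post_noise_at /condPr; congr (_ / _); apply: eq_Pr => w _;
    rewrite !inE andbC.
have clean_noiseE j : j != x d -> post_clean_at_noise pdata alpha t d j x =
    post_clean_at pdata alpha t d j x / post_noise_at pdata alpha t d x.
  move=> jx; rewrite /post_clean_at_noise noiseE /post_clean_at /condPr.
  rewrite Pr_clean_noisy_noise //; field.
  by rewrite !gt_eqF.
split=> // [j jx|].
  rewrite rateE // clean_noiseE //; split=> //; congr (_ * _).
  rewrite -[RHS]mulrA; congr (_ * _); rewrite mulrC divfK // noiseE.
  by rewrite mulf_neq0 ?invr_eq0 ?gt_eqF.
have q_gt0 : 0 < (1 - alpha t) / S%:R by rewrite divr_gt0 ?subr_gt0 ?ltr0n.
rewrite noiseE /post_clean_at /condPr.
have := Pr_data_odds pdata alpha t x d.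
have := Pr_predID (joint_pmf pdata alpha t) (noisy_is x) (noise_at d).
have := Pr_predID (joint_pmf pdata alpha t)
  [predI clean_at d (x d) & noisy_is x] (noise_at d).
rewrite -Pr_noisy_data => clean_split noisy_split odds.
(* Write [a] for [alpha t], [q] for [(1 - alpha t) / S%:R], and [c], [n] for the data and noise
   masses of the event where the clean value at [d] is [x d] and the noisy one is [x]. The odds
   [c * q = a * n] give [c * (a + q) = a * (c + n)]. *)
have data_mass : Pr (joint_pmf pdata alpha t) [predD noisy_is x & noise_at d] =
    Pr (joint_pmf pdata alpha t) [predI clean_at d (x d) & noisy_is x] *
    (alpha t / (alpha t + (1 - alpha t) / S%:R)).
  have s_neq0 : alpha t + (1 - alpha t) / S%:R != 0.
    by rewrite gt_eqF // ltr_wpDl.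
  by apply: (mulIf s_neq0); rewrite -mulrA divfK // clean_split mulrDr odds; ring.
(* The subtracted term is now the posterior probability of a data latent, so the claim is the
   complement rule. *)
rewrite mulrAC -data_mass.
apply: (mulIf (lt0r_neq0 noisy_gt0)).
rewrite mulrBl mul1r !divfK ?gt_eqF //.
by rewrite [in RHS]noisy_split addrK.
Qed.
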